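(* The group $\mathrm{Isom}_e(K_0(\mathbb{P}_4))$ is isomorphic to $\mathbb{Z}^2$. It is generated by the operators $E\mapsto E\otimes\mathcal{O}(1)$ and $E\mapsto E\otimes(\mathcal{O}+2\mathcal{O}_{\mathbb{P}_1}+3\mathcal{O}_{\mathbb{P}_0})$.
   Context: Here $n=4$ in the following. $K_0(\mathbb{P}_n)$ is the Grothendieck group of coherent sheaves on the $n$-dimensional projective space $\mathbb{P}_n$ over a fixed ground field; it is a free $\mathbb{Z}$-module of rank $n+1$ with basis the classes of $\mathcal{O},\mathcal{O}(1),\dots,\mathcal{O}(n)$. A sheaf and its class are denoted by the same letter. The Euler form is the (nonsymmetric) nondegenerate bilinear form $\chi(E,F)=\sum_\nu(-1)^\nu\dim\mathrm{Ext}^\nu(E,F)$; it satisfies $\chi(\mathcal{O}(k),\mathcal{O}(m))=\binom{n+m-k}{n}$ for all $k,m\in\mathbb{Z}$, where $\binom{x}{n}=\frac{x(x-1)\cdots(x-n+1)}{n!}$. It is extended $\mathbb{R}$-bilinearly to $K_0(\mathbb{P}_n)\otimes\mathbb{R}$. $\mathrm{Isom}(K_0(\mathbb{P}_n))$ is the group of $\mathbb{Z}$-linear automorphisms of $K_0(\mathbb{P}_n)$ preserving $\chi$; $\mathrm{Isom}(K_0(\mathbb{P}_n)\otimes\mathbb{R})\subset GL(n+1,\mathbb{R})$ is the group of $\mathbb{R}$-linear automorphisms of $K_0(\mathbb{P}_n)\otimes\mathbb{R}$ preserving $\chi$, and $\mathrm{Isom}_e(K_0(\mathbb{P}_n)\otimes\mathbb{R})$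 is its connected component of the identity. Regarding $\mathrm{Isom}(K_0(\mathbb{P}_n))$ as a subgroup of $\mathrm{Isom}(K_0(\mathbb{P}_n)\otimes\mathbb{R})$, one sets $\mathrm{Isom}_e(K_0(\mathbb{P}_n))=\mathrm{Isom}(K_0(\mathbb{P}_n))\cap \mathrm{Isom}_e(K_0(\mathbb{P}_n)\otimes\mathbb{R})$. The symbol $\otimes$ between classes denotes the commutative ring structure on $K_0(\mathbb{P}_n)$ induced by tensor product of locally free sheaves; it is the bilinear product with $\mathcal{O}(k)\otimes\mathcal{O}(m)=\mathcal{O}(k+m)$ for all $k,m\in\mathbb{Z}$. For $0\leqslant m\leqslant n$, $\mathcal{O}_{\mathbb{P}_m}$ is the class of the structure sheaf of an $m$-dimensional linear subspace $\mathbb{P}_m\subset\mathbb{P}_n$ (so $\mathcal{O}_{\mathbb{P}_n}=\mathcal{O}$); in the ring $K_0(\mathbb{P}_n)$ one has $\mathcal{O}_{\mathbb{P}_m}=(\mathcal{O}-\mathcal{O}(-1))^{n-m}$. *)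

(* Defs.v *)
From HB Require Import structures.
From mathcomp Require Import all_boot all_order all_algebra.
From mathcomp Require Import boolp classical_sets functions reals topology normedtype.

Set Implicit Arguments.
Unset Strict Implicit.
Unset Printing Implicit Defensive.

Import Order.TTheory GRing.Theory Num.Theory.
Import numFieldNormedType.Exports.
Local Open Scope ring_scope.
Local Open Scope classical_set_scope.

Definition gbin (x : int) (n : nat) : int :=
  ((\prod_(i < n) (x - i%:Z)) %/ n`!%:Z)%Z.

(* Row vectors of coordinates in the basis O, O(1), ..., O(n) of K_0(P_n);
   for a ring S, 'rV[S]_n.+1 is K_0(P_n) (x) S in the same basis. *)
Notation K0 n := 'rV[int]_n.+1.

(* The matrix sending O(i) to O(i+1) for i <= n, where O(n+1) is expressed in
   the basis through the Koszul relation
   \sum_(i <= n+1) (-1)^i 'C(n+1, i) O(i) = 0.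
   Matrices act on row vectors from the right. *)
Definition twist (n : nat) : 'M[int]_n.+1 :=
  \matrix_(i, j) if (i < n)%N then (j == i.+1 :> nat)%:R
                 else (-1) ^+ (n - j) * 'C(n.+1, j)%:R.

(* The class of O(k), for every integer k; see OO_basis, tensor_OO and chi_OO. *)
Definition OO (n : nat) (k : int) : K0 n := row ord0 (twist n ^ k).

Definition tensor (n : nat) (E F : K0 n) : K0 n :=
  \sum_(i < n.+1) \sum_(j < n.+1) (E ord0 i * F ord0 j) *: OO n (i%:Z + j%:Z).

Definition OP (n m : nat) : K0 n :=
  iter (n - m) (tensor (OO n 0 - OO n (-1))) (OO n 0).

Definition chi (S : comUnitRingType) (n : nat) (E F : 'rV[S]_n.+1) : S :=
  \sum_(i < n.+1) \sum_(j < n.+1)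
    E ord0 i * F ord0 j * (gbin (n%:Z + j%:Z - i%:Z) n)%:~R.

Definition Isom (S : comUnitRingType) (n : nat) : set 'M[S]_n.+1 :=
  [set A | A \is a GRing.unit /\
           forall E F : 'rV[S]_n.+1, chi (E *m A) (F *m A) = chi E F].
Arguments Isom : clear implicits.

(* Topology of 'M[R]_n.+1: entrywise, i.e. that of R^((n+1)^2). *)
Definition Isom_e_real (R : realType) (n : nat) : set 'M[R]_n.+1 :=
  connected_component (Isom R n) 1.
Arguments Isom_e_real : clear implicits.

Definition Isom_e (R : realType) (n : nat) : set 'M[int]_n.+1 :=
  [set A | Isom int n A /\ Isom_e_real R n (map_mx intr A)].
Arguments Isom_e : clear implicits.

Definition tensor_op (n : nat) (F : K0 n) : 'M[int]_n.+1 :=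
  lin1_mx (fun E : K0 n => tensor E F).

(* The unit condition is not automatic: x^-1 = x when x is not invertible. *)
Definition is_subgroup (U : unitRingType) (H : set U) : Prop :=
  [/\ forall x, H x -> x \is a GRing.unit,
      H 1,
      forall x y, H x -> H y -> H (x * y) &
      forall x, H x -> H x^-1].

Section Facts.

Lemma gbinE (x : int) (n : nat) :
  gbin x n * n`!%:Z = \prod_(i < n) (x - i%:Z).
Proof.
rewrite /gbin divzK //.
have nat_case m : \prod_(i < n) (m%:Z - i%:Z) = (m ^_ n)%:Z.
  elim: n => [|n IH]; first by rewrite big_ord0.
  rewrite big_ord_recr /= IH ffactnSr PoszM.
  case: (leqP n m) => h; first by rewrite subzn.
  by rewrite ffact_small // !mul0r.
case: x => m; first by rewrite nat_case dvdzE /= -bin_ffact dvdn_mull.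
rewrite NegzE (eq_bigr (fun i : 'I_n => -1 * (m.+1%:Z + i%:Z))); last first.
  by move=> i _; rewrite mulN1r opprD.
rewrite big_split /= prodr_const card_ord.
have -> : \prod_(i < n) (m.+1%:Z + i%:Z) = ((m + n) ^_ n)%:Z.
  rewrite -nat_case (reindex_inj rev_ord_inj) /=.
  apply: eq_bigr => i _; have hi := ltn_ord i.
  rewrite -PoszD subzn; last by rewrite ltnW // ltn_addl.
  by congr Posz; rewrite addnBA // addSn subSS.
by apply: dvdz_mull; rewrite dvdzE /= -bin_ffact dvdn_mull.
Qed.

Lemma gbinS (x : int) (n : nat) : gbin (x + 1) n.+1 - gbin x n.+1 = gbin x n.
Proof.
have nz : (n.+1)`!%:Z != 0 by rewrite -lt0n fact_gt0.
apply: (mulIf nz); rewrite mulrBl !gbinE.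
rewrite factS PoszM [gbin x n * _]mulrCA gbinE.
rewrite big_ord_recl big_ord_recr /= subr0.
rewrite (eq_bigr (fun i : 'I_n => x - i%:Z)); last first.
  by move=> i _; rewrite /bump /= add1n -addn1 PoszD opprD addrACA subrr addr0.
rewrite -[X in X - _]mulrC -mulrBr mulrC; congr (_ * _).
by rewrite opprB addrC addrA subrK -addn1 PoszD.
Qed.

Definition altsum (m : nat) (g : int -> int) (k : int) : int :=
  \sum_(i < m.+1) (-1) ^+ i * 'C(m, i)%:R * g (k + i%:Z).

Lemma altsumS m g k : altsum m.+1 g k = altsum m g k - altsum m g (k + 1).
Proof.
rewrite /altsum big_ord_recl /= [in X in _ = X - _]big_ord_recl /= -addrA.
rewrite !bin0; congr (_ + _).
rewrite (eq_bigr (fun i : 'I_m.+1 =>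
   (-1) ^+ i.+1 * 'C(m, i.+1)%:R * g (k + i.+1%:Z)
   - (-1) ^+ i * 'C(m, i)%:R * g (k + 1 + i%:Z))); last first.
  move=> i _; rewrite /bump /= add1n binS natrD mulrDr mulrDl; congr (_ + _).
  by rewrite exprS mulN1r !mulNr -addrA -intS.
rewrite big_split /= sumrN; congr (_ - _).
by rewrite big_ord_recr /= bin_small // mulr0 mul0r addr0.
Qed.

Lemma altsumB m g h k :
  altsum m g k - altsum m h k = altsum m (fun x => g x - h x) k.
Proof. by rewrite -sumrB; apply: eq_bigr => i _; rewrite mulrBr. Qed.

Lemma eq_altsum m g h k : g =1 h -> altsum m g k = altsum m h k.
Proof. by move=> e; apply: eq_bigr => i _; rewrite e. Qed.

Lemma altsum_shift m g k : altsum m g (k + 1) = altsum m (fun x => g (x + 1)) k.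
Proof. by apply: eq_bigr => i _; rewrite addrAC. Qed.

Lemma altsum_gbin n c k : altsum n.+1 (fun x => gbin (c + x) n) k = 0.
Proof.
elim: n c k => [|n IH] c k.
  by rewrite altsumS altsum_shift altsumB /altsum big1 // => i _;
     rewrite /gbin !big_ord0 subrr mulr0.
rewrite altsumS altsum_shift -opprB altsumB.
by rewrite (eq_altsum _ _ (h := fun x => gbin (c + x) n)) ?IH ?oppr0 // => x;
   rewrite addrA gbinS.
Qed.

Lemma altsum_gbinN n c k : altsum n.+1 (fun x => gbin (c - x) n) k = 0.
Proof.
elim: n c k => [|n IH] c k.
  by rewrite altsumS altsum_shift altsumB /altsum big1 // => i _;
     rewrite /gbin !big_ord0 subrr mulr0.
rewrite altsumS altsum_shift altsumB.
rewrite (eq_altsum _ _ (h := fun x => gbin (c - 1 - x) n)) ?IH // => x.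
by rewrite -[in RHS]gbinS [c - 1 - x]addrAC subrK opprD addrA.
Qed.

Variable n : nat.
Local Notation T := (twist n).
Local Notation e i := (delta_mx (ord0 : 'I_1) i : K0 n).

Lemma twist_col (g : int -> int) k : (forall l, altsum n.+1 g l = 0) ->
  T *m (\col_j g (k + j%:Z)) = \col_j g (k + 1 + j%:Z).
Proof.
move=> g0; apply/colP => i; rewrite !mxE.
under eq_bigr do rewrite !mxE.
case: (ltnP i n) => hi.
  rewrite (bigD1 (inord i.+1)) //= inordK // eqxx mul1r big1 ?addr0.
    by rewrite intS addrA.
  move=> j; rewrite -val_eqE /= inordK // => /negbTE ->.
  by rewrite mul0r.
have -> : i%:Z = n by congr Posz; apply/eqP; rewrite eqn_leq hi -ltnS ltn_ord.
have := g0 k; rewrite /altsum big_ord_recr /= binn mulr1 => /eqP.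
rewrite addr_eq0 => /eqP h.
transitivity ((-1) ^+ n * \sum_(j < n.+1)
    (-1) ^+ j * 'C(n.+1, j)%:R * g (k + j%:Z)).
  rewrite big_distrr /=; apply: eq_bigr => j _; rewrite !mulrA -exprD.
  do 2! congr (_ * _); rewrite -signr_odd -[RHS]signr_odd.
  by rewrite oddB ?oddD // -ltnS.
rewrite h exprS mulN1r mulNr opprK mulrA -exprD addnn -signr_odd odd_double.
by rewrite expr0 mul1r -addrA -intS.
Qed.

Lemma row_twist (i : 'I_n.+1) : (i < n)%N -> e i *m T = e (inord i.+1).
Proof.
move=> hi; rewrite -rowE; apply/rowP => j; rewrite !mxE hi eqxx /=.
by rewrite -val_eqE /= inordK.
Qed.

Lemma row_twistX (i : 'I_n.+1) : e ord0 *m T ^+ i = e i.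
Proof.
case: i => i; elim: i => [|i IH] hi /=.
  by rewrite mulmx1; congr delta_mx; apply: val_inj.
rewrite exprSr mulmxA (IH (ltnW hi)) row_twist //.
by congr delta_mx; apply: val_inj; rewrite /= inordK.
Qed.

Lemma row_expand (E : K0 n) : E = e ord0 *m \sum_i E ord0 i *: T ^+ i.
Proof.
rewrite [LHS]row_sum_delta mulmx_sumr; apply: eq_bigr => i _.
by rewrite -scalemxAr row_twistX.
Qed.

Lemma comm_mx_eq (A B : 'M[int]_n.+1) :
  GRing.comm A T -> GRing.comm B T -> e ord0 *m A = e ord0 *m B -> A = B.
Proof.
move=> cA cB h; apply/row_matrixP => i; rewrite !rowE -row_twistX -!mulmxA.
have cX C : GRing.comm C T -> T ^+ i *m C = C *m T ^+ i.
  by move=> c; exact/esym/(commrX i c).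
by rewrite (cX _ cA) (cX _ cB) !mulmxA h.
Qed.

Lemma comm_row_sum (E : K0 n) : GRing.comm (\sum_i E ord0 i *: T ^+ i) T.
Proof.
apply/commr_sym/commr_sum => i _.
by rewrite /GRing.comm -scalerAr -scalerAl -exprS -exprSr.
Qed.

Lemma twist_unit : T \is a GRing.unit.
Proof.
have := row_expand (row ord_max T); set P := \sum_i _ => hP.
have hT : T ^+ n.+1 = P.
  apply: comm_mx_eq; [exact/commr_sym/commrX|exact: comm_row_sum|].
  by rewrite -hP exprSr mulmxA rowE -(row_twistX ord_max).
set Q := \sum_(i < n) row ord_max T ord0 (lift ord0 i) *: T ^+ i.
have : T * ((-1) ^+ n *: (T ^+ n - Q)) = 1.
  rewrite -scalerAr mulrBr -exprS hT /P big_ord_recl /= !mxE ltnn subn0 bin0 mulr1.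
  have -> : T * Q = \sum_(i < n) row ord_max T ord0 (lift ord0 i) *: T ^+ bump 0 i.
    by rewrite /Q mulr_sumr; apply: eq_bigr => i _; rewrite -scalerAr -exprS.
  rewrite addrK scalerA expr0 -exprD addnn -signr_odd odd_double.
  by rewrite expr0 scale1r.
by case/mulmx1_unit.
Qed.

Lemma OOE k : OO n k = e ord0 *m T ^ k.
Proof. exact: rowE. Qed.

Lemma OO_basis (i : 'I_n.+1) : OO n i%:Z = e i.
Proof. by rewrite /OO rowE; exact: row_twistX. Qed.

Lemma OO_coord (g : int -> int) k : (forall l, altsum n.+1 g l = 0) ->
  g k = \sum_j OO n k ord0 j * g j%:Z.
Proof.
move=> g0.
pose v l : 'cV[int]_n.+1 := \col_j g (l + j%:Z).
have vS l : T *m v l = v (l + 1) by exact: twist_col.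
have vX l : T ^ l *m v 0 = v l.
  elim/int_ind: l => [|l IH|l IH]; first by rewrite expr0z mul1mx.
    by rewrite exprSz -mulmxA IH vS intS addrC.
  have -> : - l.+1%:Z = -1 - l%:Z by rewrite intS opprD.
  rewrite exprzDr ?twist_unit // -mulmxA IH exprN1 -[RHS](mulKmx twist_unit) vS.
  by rewrite addrAC addNr add0r.
have /colP/(_ ord0) := vX k; rewrite !mxE addr0 => <-.
by apply: eq_bigr => j _; rewrite !mxE add0r.
Qed.

Lemma chi_OO k m : chi (OO n k) (OO n m) = gbin (n%:Z + m - k) n.
Proof.
rewrite (OO_coord (g := fun x => gbin (n%:Z + m - x) n)); last exact: altsum_gbinN.
apply: eq_bigr => i _.
have -> : n%:Z + m - i%:Z = (n%:Z - i%:Z) + m by rewrite addrAC.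
rewrite (OO_coord (g := fun x => gbin (n%:Z - i%:Z + x) n)); last exact: altsum_gbin.
by rewrite mulr_sumr; apply: eq_bigr => j _; rewrite intz mulrA [n%:Z + _ - _]addrAC.
Qed.

Lemma tensorE (E F : K0 n) : tensor E F = E *m \sum_i F ord0 i *: T ^+ i.
Proof.
rewrite /tensor exchange_big /= mulmx_sumr; apply: eq_bigr => j _.
rewrite -scalemxAr [in RHS](row_expand E) -mulmxA.
have -> : (\sum_i E ord0 i *: T ^+ i) *m T ^+ j = \sum_i E ord0 i *: T ^+ (i + j).
  by rewrite mulmx_suml; apply: eq_bigr => i _; rewrite -scalemxAl exprD.
rewrite mulmx_sumr scaler_sumr; apply: eq_bigr => i _.
by rewrite OOE -PoszD -scalemxAr scalerA mulrC.
Qed.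

Lemma tensor_OO k m : tensor (OO n k) (OO n m) = OO n (k + m).
Proof.
rewrite tensorE.
have -> : \sum_i OO n m ord0 i *: T ^+ i = T ^ m.
  apply: comm_mx_eq; [exact: comm_row_sum|exact/commr_sym/commrXz|].
  by rewrite -row_expand OOE.
by rewrite !OOE -mulmxA exprzDr ?twist_unit.
Qed.

Lemma mul_tensor_op (E F : K0 n) : E *m tensor_op F = tensor E F.
Proof.
have -> : tensor_op F = lin1_mx (mulmxr (\sum_i F ord0 i *: T ^+ i)).
  by congr lin1_mx; apply/funext => E'; exact: tensorE.
by rewrite mul_rV_lin1 /= tensorE.
Qed.

End Facts.

(* Main.v *)
Require Import Defs.
From HB Require Import structures.
From mathcomp Require Import all_boot all_order all_algebra ring.
From mathcomp Require Import boolp classical_sets functions reals topology normedtype derive.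

Set Implicit Arguments.
Unset Strict Implicit.
Unset Printing Implicit Defensive.

Import Order.TTheory GRing.Theory Num.Theory.
Import numFieldNormedType.Exports.
Local Open Scope ring_scope.
Local Open Scope classical_set_scope.

(* Let [T] be the twist by O(1) and [N = T - 1], so that [N^5 = 0].  By Serre
   duality an isometry commutes with [T^5], hence with [T], since [N] is a
   polynomial in [T^5 - 1] over a field of characteristic 0.  It is therefore a
   polynomial [p(N)], and preserving [chi] means [p(T - 1) p(T^-1 - 1) = 1].  This
   forces [p(0) = 1] or [p(0) = -1], and for [p(0) = 1] it leaves exactly the
   two-parameter group [T^x (1 + y (2 N^3 - 3 N^4))].  Since [p(0)] is a continuous
   function of the isometry, that group is the identity component; it consists of
   integral matrices exactly when [x] and [y] are integers. *)

(** * Nilpotent elements and the operator [T - 1] *)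

(** Modulo higher powers of [x], the [k]-th power of [x w(x)] is [w(0)^k x^k]. Descending induction
    on [k > 0], starting from [x^n = 0], shows that [a] commutes with [x^k p(x)] for every [p]. *)
Lemma comm_horner_alg_nilpotent (F : fieldType) (A : algType F) (x a : A)
    (n : nat) (w : {poly F}) :
  x ^+ n = 0 -> w.[0] != 0 ->
  GRing.comm a (horner_alg x ('X * w)) -> GRing.comm a x.
Proof.
move=> xn0 w0 aw; pose h : {poly F} -> A := horner_alg x.
have hX : h 'X = x by rewrite /h /= horner_algX.
have hM (p q : {poly F}) : h (p * q) = h p * h q by rewrite /h rmorphM.
have hE (p : {poly F}) k : h ('X^k * p) = p.[0] *: x ^+ k + h ('X^(k.+1) * (p %/ 'X)).
  have {1}-> : p = (p.[0])%:P + 'X * (p %/ 'X).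
    rewrite [LHS](divp_eq p 'X) addrC mulrC; congr (_ + _).
    have := modp_XsubC p 0; rewrite subr0 => ->.
    by [].
  rewrite mulrDr mulrA -exprSr /h rmorphD /=; congr (_ + _).
  by rewrite rmorphM rmorphXn /= horner_algX horner_algC -scalerAr mulr1.
suff H k : (0 < k)%N -> forall p : {poly F}, GRing.comm a (h ('X^k * p)).
  by have := H 1%N isT 1; rewrite mulr1 expr1 hX.
have [m] := ubnP (n - k); elim: m k => // m IH k; rewrite ltnS => km k0 p.
have [nk|kn] := leqP n k.
  rewrite hM /h rmorphXn /= horner_algX -(subnK nk) exprD xn0 mulr0 mul0r.
  exact: commr0.
have {}IH (q : {poly F}) : GRing.comm a (h ('X^(k.+1) * q)).
  by apply: IH => //; rewrite subnS; case: (n - k)%N (subn_gt0 k n) km => [|j]; rewrite ?kn.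
have cxk : GRing.comm a (x ^+ k).
  have := commrX k aw; rewrite -rmorphXn /= exprMn -/h hE => /commrB /(_ (IH (w ^+ k %/ 'X))).
  rewrite addrK /GRing.comm -scalerAl -scalerAr horner_exp.
  by apply: scalerI; rewrite expf_neq0.
rewrite hE; apply: commrD => //.
by rewrite /GRing.comm -scalerAl -scalerAr cxk.
Qed.

(** Applied to [O], this is the Koszul relation stored in the last row of [twist]; both sides
    commute with [twist], so the image of [O] decides. *)
Lemma twist_sub1_nilpotent n : (twist n - 1) ^+ n.+1 = 0.
Proof.
rewrite -opprB exprNn; suff -> : (1 - twist n) ^+ n.+1 = 0 by rewrite mulr0.
have c1 : GRing.comm (1 : 'M_n.+1) (twist n) by exact/commr_sym/commr1.
apply: comm_mx_eq; [|exact/commr_sym/commr0|].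
  by apply/commr_sym/commrX/commrB => //; exact: commr1.
have -> : (1 - twist n) ^+ n.+1 =
    \sum_(i < n.+2) ((-1) ^+ i * 'C(n.+1, i)%:R) *: twist n ^+ i.
  rewrite (exprBn_comm _ c1); apply: eq_bigr => i _; rewrite expr1n mulr1.
  rewrite -[in LHS]signr_odd -[in RHS]signr_odd; case: odd.
    by rewrite !expr1 !mulN1r scaleNr scaler_nat mulNrn.
  by rewrite !expr0 !mul1r scaler_nat.
rewrite mulmx0 mulmx_sumr big_ord_recr /= -scalemxAr [twist n ^+ n.+1]exprSr mulmxA.
rewrite (row_twistX ord_max) -rowE; apply/rowP => j; rewrite !mxE summxE.
rewrite (bigD1 j) //= big1 ?addr0 => [|i /negbTE ij]; rewrite -scalemxAr row_twistX !mxE.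
  rewrite ltnn !eqxx binn !mulr1.
  rewrite mulrA -exprD addSn exprS mulN1r.
  (* The two terms that survive at [j] have signs [(-1)^j] and [(-1)^(n+1+n-j)], which are
     opposite. *)
  have -> : (n + (n - j) = j + (n - j).*2)%N.
    by rewrite -addnn addnA subnKC // -ltnS.
  by rewrite exprD -[(-1) ^+ _.*2]signr_odd odd_double mulr1 mulNr subrr.
by rewrite eqxx eq_sym ij mulr0.
Qed.

(** * The Gram matrix of the Euler form *)

(** The Gram matrix of [chi] is the case [k = n]; leaving [k] free turns a twist on either side into
    a shift of [k]. *)
Definition euler_mx n (k : int) : 'M[int]_n.+1 :=
  \matrix_(i, j) gbin (k + j%:Z - i%:Z) n.

Lemma mul_twist_euler_mx n k : twist n *m euler_mx n k = euler_mx n (k - 1).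
Proof.
apply/matrixP => i j.
have /colP/(_ i) := twist_col (g := fun x => gbin (k + j%:Z - x) n) 0
  (fun l => altsum_gbinN n (k + j%:Z) l).
rewrite !mxE => h; rewrite [RHS](_ : _ = gbin (k + j%:Z - (0 + 1 + i%:Z)) n).
  by rewrite -h; apply: eq_bigr => l _; rewrite !mxE add0r.
by congr gbin; ring.
Qed.

Lemma mul_euler_mx_twist n k : euler_mx n k *m (twist n)^T = euler_mx n (k + 1).
Proof.
apply: trmx_inj; rewrite trmx_mul trmxK; apply/matrixP => i j.
have /colP/(_ i) := twist_col (g := fun x => gbin (k - j%:Z + x) n) 0
  (fun l => altsum_gbin n (k - j%:Z) l).
rewrite !mxE => h; rewrite [RHS](_ : _ = gbin (k - j%:Z + (0 + 1 + i%:Z)) n).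
  rewrite -h; apply: eq_bigr => l _; rewrite !mxE add0r; congr (_ * gbin _ _).
  by ring.
by congr gbin; ring.
Qed.

(** The reflection reverses the order of the [n] factors of the numerator and changes the sign of
    each. *)
Lemma gbin_opp n x : gbin (n%:Z - 1 - x) n = (-1) ^+ n * gbin x n.
Proof.
have nz : n`!%:Z != 0 by rewrite -lt0n fact_gt0.
apply: (mulIf nz); rewrite -mulrA !gbinE.
rewrite (reindex_inj rev_ord_inj) -[X in (-1) ^+ X](card_ord n) -prodr_const.
rewrite -big_split /=; apply: eq_bigr => i _.
rewrite -subzn // -addn1 PoszD; ring.
Qed.

(* Serre duality: the canonical class of P_n is O(-n-1). *)
Lemma twist_exp_euler_mx n :
  twist n ^+ n.+1 *m euler_mx n n = (-1) ^+ n *: (euler_mx n n)^T.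
Proof.
have twX m k : twist n ^+ m *m euler_mx n k = euler_mx n (k - m%:Z).
  elim: m k => [|m IH] k; first by rewrite expr0 mul1mx subr0.
  by rewrite exprSr -mulmxA mul_twist_euler_mx IH intS opprD addrA.
rewrite twX; apply/matrixP => i j; rewrite !mxE -gbin_opp; congr gbin.
by rewrite intS; ring.
Qed.

(** The matrix is unitriangular: for [j < i] the entry is a binomial [x] over [n] with [0 <= x < n],
    and on the diagonal [x = n]. *)
Lemma det_euler_mx n : \det (euler_mx n n) = 1.
Proof.
rewrite -det_tr det_trig; last first.
  apply/is_trig_mxP => i j ij; rewrite !mxE.
  have nz : n`!%:Z != 0 by rewrite -lt0n fact_gt0.
  apply: (mulIf nz); rewrite gbinE mul0r.
  have hn : (n + i - j < n)%N.
    by rewrite ltn_subLR ?(leq_trans (ltnSE (ltn_ord j))) ?leq_addr // addnC ltn_add2r.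
  apply/eqP/prodf_eq0; exists (Ordinal hn) => //=.
  rewrite -subzn ?PoszD ?subrr //.
  by rewrite (leq_trans (ltnSE (ltn_ord j))) ?leq_addr.
apply: big1 => i _; rewrite !mxE addrK.
have nz : n`!%:Z != 0 by rewrite -lt0n fact_gt0.
apply: (mulIf nz); rewrite gbinE mul1r.
rewrite (reindex_inj rev_ord_inj) /= fact_prod big_add1 /= big_mkord.
rewrite (big_morph _ PoszM (erefl _)); apply: eq_bigr => k _.
by rewrite subzn ?subKn // ?leq_subr.
Qed.

(** * Isometries as matrices, and their commutation with the twist *)

Local Notation "A %:RM" := (map_mx intr A) (at level 2, format "A %:RM").

Lemma map_intr_int m n (A : 'M[int]_(m, n)) : A%:RM = A.
Proof. by apply/matrixP => i j; rewrite mxE intz. Qed.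

Lemma chiE (S : comUnitRingType) n (E F : 'rV[S]_n.+1) :
  chi E F = (E *m (euler_mx n n)%:RM *m F^T) ord0 ord0.
Proof.
rewrite mxE /chi exchange_big /=; apply: eq_bigr => j _.
rewrite !mxE mulr_suml; apply: eq_bigr => i _; rewrite !mxE.
by rewrite -!mulrA; congr (_ * _); rewrite mulrC.
Qed.

Lemma IsomE (S : comUnitRingType) n (A : 'M[S]_n.+1) :
  Isom S n A <-> A \is a GRing.unit /\
    A *m (euler_mx n n)%:RM *m A^T = (euler_mx n n)%:RM.
Proof.
split=> -[uA iA]; split=> //; last first.
  by move=> E F; rewrite !chiE trmx_mul -[in RHS]iA !mulmxA.
have entry (B : 'M[S]_n.+1) i j :
    B i j = (delta_mx ord0 i *m B *m (delta_mx ord0 j)^T : 'M_1) ord0 ord0.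
  by rewrite trmx_delta -rowE -colE !mxE.
apply/matrixP => i j; rewrite !entry -chiE -iA chiE trmx_mul.
by rewrite !mulmxA.
Qed.

Lemma euler_mx_unit (S : comUnitRingType) n :
  (euler_mx n n)%:RM \in @unitmx S n.+1.
Proof. by rewrite unitmxE det_map_mx det_euler_mx rmorph1 unitr1. Qed.

(** Serre duality reads [U X = (-1)^n X^T]. As [A] preserves both [X] and [X^T], one gets
    [A U X A^T = U X = U A X A^T], and [X A^T] cancels. *)
Lemma Isom_comm_twist_exp (S : comUnitRingType) n (A : 'M[S]_n.+1) :
  Isom S n A -> GRing.comm A ((twist n)%:RM ^+ n.+1).
Proof.
move=> /IsomE[uA iA]; set X := (euler_mx n n)%:RM in iA.
set U := _ ^+ _.
have UX : U *m X = (-1) ^+ n *: X^T.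
  rewrite /U /X -rmorphXn -map_mxM twist_exp_euler_mx map_mxZ map_trmx.
  by rewrite rmorphXn rmorphN1.
have uX : X *m A^T \in unitmx by rewrite unitmx_mul euler_mx_unit unitmx_tr.
rewrite /GRing.comm; apply: (can_inj (mulmxK uX)).
rewrite -!mulmxE -[RHS]mulmxA [A *m (X *m _)]mulmxA iA UX.
rewrite mulmxA -[A *m U *m X]mulmxA UX -scalemxAr -scalemxAl; congr (_ *: _).
by rewrite -[in RHS]iA !trmx_mul trmxK mulmxA.
Qed.

Definition tdiff (S : comUnitRingType) n : 'M[S]_n.+1 := (twist n - 1)%:RM.

Lemma tdiff_nilpotent (S : comUnitRingType) n :
  tdiff S n ^+ n.+1 = 0.
Proof. by rewrite /tdiff -rmorphXn twist_sub1_nilpotent /= map_mx0. Qed.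

Lemma twistE (S : comUnitRingType) n :
  (twist n)%:RM = 1 + tdiff S n.
Proof. by rewrite /tdiff map_mxB map_mx1 addrC subrK. Qed.

Lemma Isom_comm_twist (F : numFieldType) n (A : 'M[F]_n.+1) :
  Isom F n A -> GRing.comm A (twist n)%:RM.
Proof.
move=> /Isom_comm_twist_exp cA; rewrite twistE; apply: commrD; first exact: commr1.
(* This is [((1 + X)^(n+1) - 1) / X]; its constant term is [n + 1], nonzero in characteristic 0. *)
pose w : {poly F} := \sum_(i < n.+1) 'C(n.+1, i.+1)%:R *: 'X^i.
apply: (@comm_horner_alg_nilpotent _ _ _ _ n.+1 w).
- exact: tdiff_nilpotent.
- rewrite horner_sum big_ord_recl big1 /= ?addr0 => [|i _].
    by rewrite hornerZ expr0 hornerC mulr1 bin1 pnatr_eq0.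
  by rewrite hornerZ hornerXn expr0n mulr0.
have -> : horner_alg (tdiff F n) ('X * w) = (twist n)%:RM ^+ n.+1 - 1.
  have -> : 'X * w = (1 + 'X) ^+ n.+1 - 1.
    rewrite exprDn big_ord_recl /= expr0 bin0 expr1n mulr1 mulr1n addrC addKr.
    rewrite mulr_sumr; apply: eq_bigr => i _.
    by rewrite expr1n mul1r -scalerAr -exprS scaler_nat.
  by rewrite rmorphB rmorphXn rmorphD rmorph1 /= horner_algX -twistE.
by apply: commrB => //; exact: commr1.
Qed.

(** * Polynomials in the twist and truncated series in [N = T - 1] *)

Lemma delta_twistX (S : comUnitRingType) n (i : 'I_n.+1) :
  delta_mx ord0 ord0 *m (twist n)%:RM ^+ i = delta_mx ord0 i :> 'rV[S]_n.+1.
Proof.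
by rewrite -rmorphXn -(map_delta_mx intr) -map_mxM row_twistX map_delta_mx.
Qed.

(** [O] is a cyclic vector for the twist, so an operator commuting with the twist is determined by
    its first row, the image of [O]. *)
Lemma comm_twistE (S : comUnitRingType) n (A : 'M[S]_n.+1) :
  GRing.comm A (twist n)%:RM ->
  A = \sum_(i < n.+1) A ord0 i *: (twist n)%:RM ^+ i.
Proof.
move=> cA; apply/row_matrixP => k; rewrite !rowE -delta_twistX -!mulmxA.
have cX (B : 'M[S]_n.+1) : GRing.comm B (twist n)%:RM ->
    (twist n)%:RM ^+ k *m B = B *m (twist n)%:RM ^+ k.
  by move=> c; exact/esym/(commrX k c).
rewrite !cX //; last first.
  apply/commr_sym/commr_sum => i _.
  by rewrite /GRing.comm -scalerAr -scalerAl -exprS -exprSr.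
rewrite !mulmxA; congr (_ *m _); rewrite mulmx_sumr -rowE [LHS]row_sum_delta.
by apply: eq_bigr => i _; rewrite -scalemxAr delta_twistX mxE.
Qed.

(** Naming the five coefficients reduces identities between such operators to scalar ones. *)
Definition tser (S : comUnitRingType) (c0 c1 c2 c3 c4 : S) : 'M[S]_5 :=
  let N := tdiff S 4 in
  c0%:M + c1 *: N + c2 *: N ^+ 2 + c3 *: N ^+ 3 + c4 *: N ^+ 4.

Lemma tser_horner (S : comUnitRingType) (c0 c1 c2 c3 c4 : S) :
  tser c0 c1 c2 c3 c4 = horner_mx (tdiff S 4)
    (c0%:P + c1%:P * 'X + c2%:P * 'X^2 + c3%:P * 'X^3 + c4%:P * 'X^4).
Proof.
by rewrite !mul_polyC !rmorphD /= !horner_mxZ !rmorphXn /= horner_mx_X horner_mx_C.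
Qed.

Lemma tserM (S : comUnitRingType) (c0 c1 c2 c3 c4 d0 d1 d2 d3 d4 : S) :
  tser c0 c1 c2 c3 c4 * tser d0 d1 d2 d3 d4 =
  tser (c0 * d0) (c0 * d1 + c1 * d0) (c0 * d2 + c1 * d1 + c2 * d0)
       (c0 * d3 + c1 * d2 + c2 * d1 + c3 * d0)
       (c0 * d4 + c1 * d3 + c2 * d2 + c3 * d1 + c4 * d0).
Proof.
rewrite !tser_horner -rmorphM /=; set p := (X in horner_mx _ X = _).
set q := (X in _ = horner_mx _ X).
(* The cofactor of [X^5] collects the terms of degree 5 to 8, which vanish at [N]. *)
have -> : p = q + 'X^5 * ((c1 * d4 + c2 * d3 + c3 * d2 + c4 * d1)%:P
   + (c2 * d4 + c3 * d3 + c4 * d2)%:P * 'X + (c3 * d4 + c4 * d3)%:P * 'X^2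
   + (c4 * d4)%:P * 'X^3) by rewrite /p /q; ring.
rewrite rmorphD rmorphM rmorphXn /= horner_mx_X tdiff_nilpotent mul0r.
by rewrite addr0.
Qed.

Lemma tser1 (S : comUnitRingType) : tser 1 0 0 0 0 = 1 :> 'M[S]_5.
Proof. by rewrite /tser !scale0r !addr0. Qed.

Lemma tser_twist (S : comUnitRingType) : tser 1 1 0 0 0 = (twist 4)%:RM :> 'M[S]_5.
Proof. by rewrite /tser !scale0r scale1r !addr0 -twistE. Qed.

Lemma map_tser (S : comUnitRingType) (c0 c1 c2 c3 c4 : int) :
  (tser c0 c1 c2 c3 c4)%:RM =
  tser c0%:~R c1%:~R c2%:~R c3%:~R c4%:~R :> 'M[S]_5.
Proof.
rewrite /tser !map_mxD !map_mxZ map_scalar_mx.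
by rewrite /tdiff map_intr_int !rmorphXn.
Qed.

Lemma tser_row (S : comUnitRingType) (c0 c1 c2 c3 c4 : S) (j : 'I_5) :
  tser c0 c1 c2 c3 c4 ord0 j =
  [:: c0 - c1 + c2 - c3 + c4; c1 - 2 * c2 + 3 * c3 - 4 * c4;
      c2 - 3 * c3 + 6 * c4; c3 - 4 * c4; c4]`_j.
Proof.
set d := [:: _; _; _; _; _].
have -> : tser c0 c1 c2 c3 c4 = \sum_(i < 5) d`_i *: (twist 4)%:RM ^+ i.
  have N1 : tdiff S 4 = horner_mx (twist 4)%:RM ('X - 1).
    by rewrite rmorphB rmorph1 /= horner_mx_X /tdiff map_mxB map_mx1.
  rewrite /tser N1 -!rmorphXn -(horner_mx_C (twist 4)%:RM) -!horner_mxZ -!rmorphD /=.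
  have -> : \sum_(i < 5) d`_i *: (twist 4)%:RM ^+ i
      = horner_mx (twist 4)%:RM (\sum_(i < 5) d`_i *: 'X^i).
    rewrite rmorph_sum; apply: eq_bigr => i _.
    by rewrite /= horner_mxZ rmorphXn /= horner_mx_X.
  congr (horner_mx _ _); rewrite !big_ord_recl big_ord0 /d /= -!mul_polyC.
  by ring.
have -> : forall B : 'M[S]_5, B ord0 j = (delta_mx ord0 ord0 *m B : 'rV_5) ord0 j.
  by move=> B; rewrite -rowE mxE.
rewrite mulmx_sumr summxE (bigD1 j) //= big1 ?addr0 => [|i ij].
  by rewrite -scalemxAr delta_twistX !mxE !eqxx mulr1.
by rewrite -scalemxAr delta_twistX !mxE eqxx [j == i]eq_sym (negbTE ij) mulr0.
Qed.

(** The first row depends on the coefficients by a unitriangular matrix, so they are recovered from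
    [c4] down to [c0]. *)
Lemma tser_inj (S : comUnitRingType) (c0 c1 c2 c3 c4 d0 d1 d2 d3 d4 : S) :
  tser c0 c1 c2 c3 c4 = tser d0 d1 d2 d3 d4 ->
  [/\ c0 = d0, c1 = d1, c2 = d2, c3 = d3 & c4 = d4].
Proof.
move=> h.
have e (j : 'I_5) := congr1 (fun B : 'M[S]_5 => B ord0 j) h.
have := e (inord 4); rewrite !tser_row inordK //= => e4; subst d4.
have := e (inord 3); rewrite !tser_row inordK //= => /addIr e3; subst d3.
have := e (inord 2); rewrite !tser_row inordK //= => /addIr/addIr e2; subst d2.
have := e (inord 1); rewrite !tser_row inordK //= => /addIr/addIr/addIr e1; subst d1.
by have := e ord0; rewrite !tser_row /= => /addIr/addIr/addIr/addIr ->.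
Qed.

Lemma comm_twist_tser (S : comUnitRingType) (A : 'M[S]_5) :
  GRing.comm A (twist 4)%:RM ->
  exists c1 c2 c3 c4, A = tser (\sum_j A ord0 j) c1 c2 c3 c4.
Proof.
move=> /comm_twistE AE; pose a k := A ord0 (inord k).
exists (a 1%N + 2 * a 2%N + 3 * a 3%N + 4 * a 4%N).
exists (a 2%N + 3 * a 3%N + 6 * a 4%N), (a 3%N + 4 * a 4%N), (a 4%N).
rewrite {1}AE tser_horner.
have -> : \sum_j A ord0 j = a 0%N + a 1%N + a 2%N + a 3%N + a 4%N.
  rewrite (eq_bigr (fun j : 'I_5 => a j)) => [|j _]; last by rewrite /a inord_val.
  by rewrite !big_ord_recl big_ord0 /=; ring.
rewrite (eq_bigr (fun i : 'I_5 => horner_mx (tdiff S 4) ((a i)%:P * (1 + 'X) ^+ i))).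
  rewrite -rmorph_sum; congr (horner_mx _ _); rewrite !big_ord_recl big_ord0 /=.
  by rewrite /bump /=; ring.
move=> i _; rewrite rmorphM rmorphXn rmorphD rmorph1 /= horner_mx_X horner_mx_C -twistE.
by rewrite -mulmxE mul_scalar_mx /a inord_val.
Qed.

Lemma tserC (S : comUnitRingType) (c0 c1 c2 c3 c4 d0 d1 d2 d3 d4 : S) :
  GRing.comm (tser c0 c1 c2 c3 c4) (tser d0 d1 d2 d3 d4).
Proof. by rewrite /GRing.comm !tserM; congr tser; ring. Qed.

Lemma map_intr_inj (F : numFieldType) m n :
  injective (fun A : 'M[int]_(m, n) => A%:RM : 'M[F]_(m, n)).
Proof.
move=> A B /matrixP h; apply/matrixP => i j.
by have := h i j; rewrite !mxE => /intr_inj.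
Qed.

(** Commutation with the twist descends to the integers, where [A] has an integral expansion;
    uniqueness of coefficients over [F] identifies the two. *)
Lemma tser_int (F : numFieldType) (A : 'M[int]_5) (c0 c1 c2 c3 c4 : F) :
  A%:RM = tser c0 c1 c2 c3 c4 -> exists d0 d1 d2 d3 d4 : int,
  [/\ c0 = d0%:~R, c1 = d1%:~R, c2 = d2%:~R, c3 = d3%:~R & c4 = d4%:~R].
Proof.
move=> h.
have /comm_twist_tser[d1 [d2 [d3 [d4 AE]]]] : GRing.comm A (twist 4)%:RM.
  apply: (@map_intr_inj F); rewrite map_intr_int !rmorphM /= h -tser_twist.
  exact: tserC.
move: h; rewrite {}AE map_tser => /tser_inj[<- <- <- <- <-].
by do 5! eexists.
Qed.

Lemma tserD (S : comUnitRingType) (c0 c1 c2 c3 c4 d0 d1 d2 d3 d4 : S) :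
  tser c0 c1 c2 c3 c4 + tser d0 d1 d2 d3 d4 =
  tser (c0 + d0) (c1 + d1) (c2 + d2) (c3 + d3) (c4 + d4).
Proof. by rewrite !tser_horner -rmorphD; congr (horner_mx _ _); ring. Qed.

Lemma tserZ (S : comUnitRingType) (a c0 c1 c2 c3 c4 : S) :
  a *: tser c0 c1 c2 c3 c4 =
  tser (a * c0) (a * c1) (a * c2) (a * c3) (a * c4).
Proof. by rewrite /tser !scalerDr !scalerA scale_scalar_mx. Qed.

(* The adjoint of a polynomial in [T - 1] is obtained by substituting [T^-1] for [T];
   in terms of [N = T - 1], [T^-1 - 1 = - N + N^2 - N^3 + N^4]. *)
Lemma tser_adj (S : comUnitRingType) (c0 c1 c2 c3 c4 : S) :
  (euler_mx 4 4)%:RM *m (tser c0 c1 c2 c3 c4)^T =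
  tser c0 (- c1) (c1 + c2) (- c1 - 2 * c2 - c3) (c1 + 3 * c2 + 3 * c3 + c4)
    *m (euler_mx 4 4)%:RM.
Proof.
set X := (euler_mx 4 4)%:RM; set M : 'M[S]_5 := tser 0 (-1) 1 (-1) 1.
have mE (B C : 'M[S]_5) : B *m C = B * C by [].
have TX : (twist 4)%:RM *m (X *m (twist 4)%:RM^T) = X.
  by rewrite map_trmx -!map_mxM mul_euler_mx_twist mul_twist_euler_mx addrK.
have XT : X *m (twist 4)%:RM^T = tser 1 (-1) 1 (-1) 1 *m X.
  rewrite -[in RHS]TX; move: (X *m _) => Y; rewrite mulmxA -tser_twist mulmxE tserM.
  rewrite -[LHS]mul1r -tser1; congr (_ * _).
  by congr tser; ring.
have XN : X *m (tdiff S 4)^T = M *m X.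
  have -> : tdiff S 4 = (twist 4)%:RM - 1 by rewrite twistE addrC addKr.
  have -> : M = tser 1 (-1) 1 (-1) 1 - 1.
    by rewrite -tser1 -scaleN1r tserZ tserD /M; congr tser; ring.
  by rewrite linearB /= mulmxBr XT trmx1 mulmx1 mulmxBl mul1mx.
have XNX k : X *m (tdiff S 4 ^+ k)^T = M ^+ k *m X.
  elim: k => [|k IH]; first by rewrite !expr0 trmx1 mulmx1 mul1mx.
  by rewrite exprS -mulmxE trmx_mul mulmxA IH -mulmxA XN mulmxA [_ *m M]mE -exprSr.
have -> : tser c0 (- c1) (c1 + c2) (- c1 - 2 * c2 - c3) (c1 + 3 * c2 + 3 * c3 + c4)
    = c0%:M + c1 *: M + c2 *: M ^+ 2 + c3 *: M ^+ 3 + c4 *: M ^+ 4.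
  have -> : c0%:M = tser c0 0 0 0 0 by rewrite /tser !scale0r !addr0.
  rewrite !exprS expr0 mulr1 /M !tserM !tserZ !tserD; congr tser; ring.
rewrite [in LHS]/tser; clearbody M; rewrite !linearD /= !linearZ /= !mulmxDl -!scalemxAl.
by rewrite !XNX XN tr_scalar_mx mul_mx_scalar mul_scalar_mx.
Qed.

(** * Isometries among these series *)

(** With [B] the second factor, [tser_adj] gives [A X A^T = A B X], and [X] is invertible. As the
    series commute, [A B = 1] also makes [A] a unit. *)
Lemma Isom_tser (S : comUnitRingType) (c0 c1 c2 c3 c4 : S) :
  Isom S 4 (tser c0 c1 c2 c3 c4) <->
  tser c0 c1 c2 c3 c4 * tser c0 (- c1) (c1 + c2) (- c1 - 2 * c2 - c3)
    (c1 + 3 * c2 + 3 * c3 + c4) = 1.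
Proof.
rewrite IsomE -mulmxA tser_adj mulmxA; split=> [[_ h]|h].
  by apply: (can_inj (mulmxK (euler_mx_unit S 4))); rewrite h mul1mx.
split; last by rewrite mulmxE h mul1r.
by apply/unitrP; eexists; split; last exact: h; rewrite tserC.
Qed.

(* [tflow x y] is [T^x (1 + y (2 N^3 - 3 N^4))], i.e. [exp (x D + 2 y D^3)]
   where [T = exp D]. *)
Definition tflow (F : numFieldType) (x y : F) : 'M[F]_5 :=
  tser 1 x (x * (x - 1) / 2) (x * (x - 1) * (x - 2) / 6 + 2 * y)
    (x * (x - 1) * (x - 2) * (x - 3) / 24 + 2 * x * y - 3 * y).

(** Since [2 N^3 - 3 N^4] has square zero, its factor turns sums in [y] into products, as [T^x] does
    in [x]. *)
Lemma tflowD (F : numFieldType) (x y x' y' : F) :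
  tflow x y * tflow x' y' = tflow (x + x') (y + y').
Proof. by rewrite /tflow tserM; congr tser; field. Qed.

Lemma tflow0 (F : numFieldType) : tflow 0 0 = 1 :> 'M[F]_5.
Proof. by rewrite -tser1 /tflow; congr tser; field. Qed.

Lemma tflow_inj (F : numFieldType) (x y x' y' : F) :
  tflow x y = tflow x' y' -> x = x' /\ y = y'.
Proof.
move=> /tser_inj[_ <- _ /addrI h _]; split=> //.
by apply: (mulfI _ h); rewrite pnatr_eq0.
Qed.

(** Only odd powers of [D] occur in the exponent, and the adjoint replaces [D] by [-D], so the
    adjoint is the inverse. *)
Lemma Isom_tflow (F : numFieldType) (x y : F) : Isom F 4 (tflow x y).
Proof.
apply/Isom_tser; rewrite tserM -tser1.
by congr tser; field.
Qed.

(* The coordinate sum of a class is its rank; here it is the constant term of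
   [A] as a polynomial in [T - 1]. *)
Lemma Isom_rank (F : numFieldType) (A : 'M[F]_5) : Isom F 4 A ->
  (\sum_j A ord0 j) ^+ 2 = 1.
Proof.
move=> iA; have [c1 [c2 [c3 [c4]]]] := comm_twist_tser (Isom_comm_twist iA).
move: (\sum_j _) => r AE; move: iA; rewrite AE => /Isom_tser; rewrite tserM -tser1.
by case/tser_inj.
Qed.

(** The coefficients of [N^2] and [N^4] in [p(N) p(T^-1 - 1) = 1] determine [c2] and [c4]; the free
    parameters are [x] and [c3], and [y] is read off from [c3]. *)
Lemma Isom_tflowP (F : numFieldType) (A : 'M[F]_5) : Isom F 4 A ->
  \sum_j A ord0 j = 1 -> exists x y, A = tflow x y.
Proof.
move=> iA r1; have [x [c2 [c3 [c4]]]] := comm_twist_tser (Isom_comm_twist iA).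
rewrite r1 => AE; move: iA; rewrite AE => /Isom_tser; rewrite tserM -tser1.
move=> /tser_inj[_ _ e2 _ e4]; exists x, ((c3 - x * (x - 1) * (x - 2) / 6) / 2).
have {}e2 : c2 = x * (x - 1) / 2.
  have -> : c2 = (1 * (x + c2) + x * - x + c2 * 1 - x + x ^+ 2) / 2 by field.
  by rewrite e2; field.
rewrite /tflow; congr tser => //; first by field.
(* [e] is affine in [c4] with slope 2, so [e - 2 * c4] is free of [c4]. *)
set e := (X in X = 0) in e4.
have -> : c4 = (e - (e - 2 * c4)) / 2 by field.
by rewrite {1}e4 /e e2; field.
Qed.

(** * The identity component over the reals *)

(** The rank is continuous, squares to 1 on isometries and is 1 at the identity; a connected set
    reaching -1 as well would also reach 0. *)
Lemma Isom_e_real_rank (R : realType) (A : 'M[R]_5) :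
  Isom_e_real R 4 A -> \sum_j A ord0 j = 1.
Proof.
case=> C [C1 CI Cc] CA; pose r (B : 'M[R]_5) := \sum_j B ord0 j.
have rc : continuous r.
  by apply: continuous_big => [|j _]; [exact: add_continuous|exact: coord_continuous].
have /connected_intervalP rC : connected [set r B | B in C].
  by apply: connected_continuous_connected => //; exact: continuous_subspaceT.
have r1 : r 1 = 1.
  rewrite /r (bigD1 ord0) //= big1 ?addr0 => [|i /negbTE i0]; rewrite !mxE ?eqxx //.
  by rewrite eq_sym i0.
have rsq B : C B -> r B ^+ 2 = 1 by move=> /CI; exact: Isom_rank.
have /eqP := rsq _ CA; rewrite sqrf_eq1 => /orP[/eqP //|/eqP rA].
have [B CB rB] : [set r B | B in C] 0.
  by apply: (rC (-1) 1); [exists A|exists 1|rewrite lerN10 ler01].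
by have /eqP := rsq _ CB; rewrite rB expr0n eq_sym oner_eq0.
Qed.

(** The one-parameter group [t -> tflow (t x) (t y)] is a connected set of isometries, at the
    identity for [t = 0] and at the given one for [t = 1]. *)
Lemma Isom_e_real_tflow (R : realType) (x y : R) : Isom_e_real R 4 (tflow x y).
Proof.
pose g (t : R) := tflow (t * x) (t * y).
have gc : continuous g.
  have lin (z : R) : exists Z : {poly R}, forall t, Z.[t] = t * z.
    by exists (z *: 'X) => t; rewrite hornerZ hornerX mulrC.
  have [[X XE] [Y YE]] := (lin x, lin y).
  have -> : g = fun t => tser 1 X.[t] (X * (X - 1) * (2^-1)%:P).[t]
      (X * (X - 1) * (X - 2%:P) * (6^-1)%:P + 2%:P * Y).[t]
      (X * (X - 1) * (X - 2%:P) * (X - 3%:P) * (24^-1)%:P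
        + 2%:P * X * Y - 3%:P * Y).[t].
    by apply/funext => t; rewrite !hornerE XE YE.
  move=> t; rewrite /continuous_at /tser.
  apply: cvgD; first apply: cvgD; first apply: cvgD;
    first (apply: cvgD; first exact: cvg_cst);
  by apply: cvgZr_tmp; exact: continuous_horner.
have gI : range g `<=` Isom R 4 by move=> _ [t _ <-]; exact: Isom_tflow.
exists (range g); last by exists 1 => //; rewrite /g !mul1r.
split=> //; first by exists 0 => //; rewrite /g !mul0r tflow0.
apply: connected_continuous_connected; last exact: continuous_subspaceT.
by apply/connected_intervalP.
Qed.

(** * Tensor operators and the two generators *)

(** Tensoring with [E] is the only operator that commutes with the twist and sends [O] to [E]. *)
Lemma tensor_op_mul n (B : 'M[int]_n.+1) :
  GRing.comm B (twist n) -> tensor_op (delta_mx ord0 ord0 *m B) = B.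
Proof.
move=> cB; set E := _ *m B; apply/row_matrixP => i; rewrite !rowE.
rewrite mul_tensor_op tensorE; congr (_ *m _).
apply: comm_mx_eq => //; first exact: comm_row_sum.
by rewrite -row_expand.
Qed.

Lemma comm_exp_twist_sub n k m : GRing.comm ((1 - twist n ^ k) ^+ m) (twist n).
Proof.
apply/commr_sym/commrX/commrB; first exact: commr1.
exact: commrXz.
Qed.

Lemma OPE n m : OP n m = delta_mx ord0 ord0 *m (1 - twist n ^ (-1)) ^+ (n - m).
Proof.
rewrite /OP; elim: (n - m)%N => [|k IH] /=; first by rewrite OOE expr0z expr0.
rewrite IH -mul_tensor_op tensor_op_mul; last exact: comm_exp_twist_sub.
by rewrite !OOE expr0z -mulmxBr exprS mulmxA.
Qed.

Lemma tensor_op_OO n k : tensor_op (OO n k) = twist n ^ k.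
Proof. by rewrite OOE tensor_op_mul //; exact/commr_sym/commrXz. Qed.

Lemma tser_twist_int : twist 4 = tser 1 1 0 0 0.
Proof. by rewrite tser_twist map_intr_int. Qed.

Lemma tser_unit (S : comUnitRingType) (c3 c4 : S) :
  tser 1 0 0 c3 c4 \is a GRing.unit.
Proof.
apply/unitrP; exists (tser 1 0 0 (- c3) (- c4)).
by rewrite !tserM -tser1; split; congr tser; ring.
Qed.

(** As [1 - T^-1 = N - N^2 + N^3 - N^4] has cube [N^3 - 3 N^4] and fourth power [N^4], the operator
    is [1 + 2 (N^3 - 3 N^4) + 3 N^4]. *)
Lemma tensor_op_second_generator :
  tensor_op (OO 4 0 + OP 4 1 *+ 2 + OP 4 0 *+ 3) = tser 1 0 0 2 (-3).
Proof.
have twV : twist 4 ^ (-1) = tser 1 (-1) 1 (-1) 1.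
  apply: (mulrI (twist_unit 4)); rewrite exprN1 divrr ?twist_unit //.
  by rewrite tser_twist_int tserM -tser1; congr tser; ring.
have eMn (B : 'M[int]_5) k :
    (delta_mx ord0 ord0 *m B) *+ k = delta_mx ord0 ord0 *m (B *+ k) :> K0 4.
  by rewrite linearMn.
rewrite !OPE OOE expr0z !eMn -!mulmxDr tensor_op_mul; last first.
  apply/commr_sym/commrD; [apply: commrD; first exact: commr1|];
  by apply: commrMn; exact/commr_sym/comm_exp_twist_sub.
have -> : 1 - twist 4 ^ (-1) = tser 0 1 (-1) 1 (-1).
  by rewrite twV -tser1 -scaleN1r tserZ tserD; congr tser; ring.
rewrite -tser1 !exprS expr0 !mulr1 !tserM -!scaler_nat !tserZ !tserD.
by congr tser; ring.
Qed.

(** * Integer powers and the integral group *)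

Lemma tflowXz (F : numFieldType) (x y : F) (k : int) :
  tflow x y ^ k = tflow (k%:~R * x) (k%:~R * y).
Proof.
have u : tflow x y \is a GRing.unit by case: (Isom_tflow x y).
elim/int_ind: k => [|k IH|k IH]; first by rewrite expr0z !mul0r tflow0.
  by rewrite exprSz IH tflowD intS !rmorphD !mulrDl !rmorph1 !mul1r.
apply: (mulrI u); rewrite tflowD -{1}[tflow x y]expr1z -exprzDr //.
have -> : 1 - k.+1%:Z = - k%:Z by rewrite intS; ring.
by rewrite IH intS; congr tflow; rewrite !rmorphN rmorphD rmorph1; ring.
Qed.

Lemma subgroup_exprz (U : unitRingType) (H : set U) x (k : int) :
  is_subgroup H -> H x -> H (x ^ k).
Proof.
case=> Hu H1 HM HV Hx.
have HX m : H (x ^+ m).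
  by elim: m => [|m IH]; rewrite ?expr0 // exprS; exact: HM.
by case: k => m; [exact: HX|exact/HV/HX].
Qed.

Lemma map_generators_mul (F : numFieldType) (a b : int) :
  (twist 4 ^ a * tser 1 0 0 2 (-3) ^ b)%:RM = tflow a%:~R b%:~R :> 'M[F]_5.
Proof.
have uT := twist_unit 4.
have uG : (tser 1 0 0 2 (-3) : 'M[int]_5) \is a GRing.unit by exact: tser_unit.
rewrite rmorphM !rmorphXz //= -tser_twist map_tser.
have -> : tser 1 1 0 0 0 = tflow 1 0 :> 'M[F]_5 by rewrite /tflow; congr tser; field.
have -> : tser 1%:~R 0%:~R 0%:~R 2%:~R (-3)%:~R = tflow 0 1 :> 'M[F]_5.
  by rewrite /tflow; congr tser; field.
by rewrite !tflowXz tflowD; congr tflow; ring.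
Qed.

Lemma Isom_map_intr (F : numFieldType) n (A : 'M[int]_n.+1) :
  A \is a GRing.unit -> Isom F n A%:RM -> Isom int n A.
Proof.
move=> uA /IsomE[_ iA]; apply/IsomE; split=> //; apply: (@map_intr_inj F).
by rewrite map_intr_int !map_mxM -map_trmx.
Qed.

Lemma Isom_eP (R : realType) (A : 'M[int]_5) : Isom_e R 4 A <->
  exists a b : int, A = twist 4 ^ a * tser 1 0 0 2 (-3) ^ b.
Proof.
split=> [[_ iA]|[a [b ->]]]; last first.
  split; last by rewrite map_generators_mul; exact: Isom_e_real_tflow.
  apply: (@Isom_map_intr R); last by rewrite map_generators_mul; exact: Isom_tflow.
  by rewrite unitrMl ?unitrXz ?twist_unit ?tser_unit.
have [x [y AE]] := Isom_tflowP (connected_component_sub iA) (Isom_e_real_rank iA).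
have [_ [a [_ [_ [_ [_ xE _ _ _]]]]]] := tser_int AE.
(* Dividing by [T^a] leaves [1 + 2 y N^3 - 3 y N^4], which is still integral. *)
have BE : (A * twist 4 ^ (- a))%:RM = tflow 0 y.
  have := map_generators_mul R (- a) 0; rewrite expr0z mulr1 rmorphM /= AE => ->.
  by rewrite tflowD xE rmorphN /= subrr addr0.
have [_ [_ [_ [d3 [d4 [_ _ _ y3 y4]]]]]] := tser_int BE.
(* Here [d3 = 2 y] and [d4 = -3 y], so [y = 3 y - 2 y] is an integer. *)
exists a, (- d3 - d4); apply: (@map_intr_inj R); rewrite AE map_generators_mul xE.
by congr tflow; rewrite rmorphB rmorphN /= -y3 -y4; field.
Qed.

Theorem proposition11 (R : realType) :
  (exists f : int * int -> 'M[int]_5,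
     {morph f : x y / x + y >-> x * y} /\
     set_bij [set: int * int] (Isom_e R 4) f) /\
  Isom_e R 4 =
    smallest (@is_subgroup 'M[int]_5)
      [set tensor_op (OO 4 1);
           tensor_op (OO 4 0 + OP 4 1 *+ 2 + OP 4 0 *+ 3)].
Proof.
rewrite tensor_op_OO expr1z tensor_op_second_generator.
set G := tser 1 0 0 2 (-3).
pose f (k : int * int) := twist 4 ^ k.1 * G ^ k.2.
have mapf k : (f k)%:RM = tflow k.1%:~R k.2%:~R :> 'M[R]_5 by exact: map_generators_mul.
have fM : {morph f : x y / x + y >-> x * y}.
  move=> x y; apply: (@map_intr_inj R); rewrite mapf -mulmxE map_mxM !mapf mulmxE tflowD.
  by rewrite !rmorphD.
have f0 : f 0 = 1 by rewrite /f !expr0z mulr1.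
split.
  exists f; split=> //; split.
  - by move=> k _; apply/Isom_eP; exists k.1, k.2.
  - move=> [a b] [c d] _ _ /(congr1 (fun A => A%:RM : 'M[R]_5)).
    by rewrite !mapf => /tflow_inj[/intr_inj /= -> /intr_inj /= ->].
  - by move=> A /Isom_eP[a [b ->]]; exists (a, b).
have eE : Isom_e R 4 = range f.
  apply/seteqP; split=> A; first by case/Isom_eP=> a [b ->]; exists (a, b).
  by case=> k _ <-; apply/Isom_eP; exists k.1, k.2.
(* A subgroup containing both generators contains every [T^a G^b]; conversely, the range of [f] is
   itself such a subgroup. *)
apply/seteqP; split.
  move=> A /Isom_eP[a [b ->]] H [sH gH].
  have [_ _ HM _] := sH; apply: HM; apply: subgroup_exprz => //; apply: gH; [by left|by right].
apply: bigcap_inf; split; last first.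
  rewrite eE => A [->|->]; first by exists (1, 0) => //; rewrite /f expr1z expr0z mulr1.
  by exists (0, 1) => //; rewrite /f expr1z expr0z mul1r.
have fV k : f k * f (- k) = 1 by rewrite -fM subrr.
have fU k : f k \is a GRing.unit.
  by apply/unitrP; exists (f (- k)); rewrite -!fM subrr addNr.
rewrite eE; split.
- by move=> _ [k _ <-].
- by exists 0.
- by move=> _ _ [k _ <-] [l _ <-]; exists (k + l).
- move=> _ [k _ <-]; exists (- k) => //; apply: (mulrI (fU k)).
  by rewrite fV divrr.
Qed.
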